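(* Let $\ell_x=(\ell_x^-,\ell_x^+)$ with $\ell_x^\pm\in\mathbb{R}^r_{+}$ and $\ell_u=(\ell_u^-,\ell_u^+)$ with $\ell_u^\pm\in\mathbb{R}^k$ satisfy all of the following constraints (inequalities are componentwise; the first is required for both consistent choices of sign): $$\ell_x^\pm \ \ge\ B^+\ell_u^\pm + B^-\ell_u^\mp + C^+\,\delta_2 f^\pm(\ell_x) + C^-\,\delta_2 f^\mp(\ell_x),$$ $$\ell_x^\pm\le \ell_x^{\max,\pm},$$ $$D^+\ell_u^+ + D^-\ell_u^- + E^+\,\delta_2 f^+(\ell_x) + E^-\,\delta_2 f^-(\ell_x) + h_\star \ \le\ 0 .$$ Then for every $u\in\mathbb{R}^k$ with $-\ell_u^-\le u-u^\star\le \ell_u^+$ there exists $x\in\mathbb{R}^n$ such that $$M f(x)=M f(x^\star)+R(u-u^\star),\qquad -\ell_x^-\le A(x-x^\star)\le \ell_x^+,\qquad h(x)\le 0;$$ in particular this solution satisfies the linear feasibility constraints $-\ell_x^{\max,-}\le A(x-x^\star)\le \ell_x^{\max,+}$ as well as the nonlinear feasibility constraints $h(x)\le 0$.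
   Context: Data: $f:\mathbb{R}^n\to\mathbb{R}^m$ is a differentiable map, $M\in\mathbb{R}^{n\times m}$, $R\in\mathbb{R}^{n\times k}$, $T\in\mathbb{R}^{l\times m}$, and $x^\star\in\mathbb{R}^n$, $u^\star\in\mathbb{R}^k$ are base points. The nonlinear feasibility constraint is $h(x)\le 0$ with $h(x)=Tf(x)$; put $h_\star=h(x^\star)$ and assume $h_\star\le 0$. Put $L=\frac{\partial f}{\partial x}\big|_{x^\star}$ and $J_\star=ML\in\mathbb{R}^{n\times n}$, which is assumed nonsingular. Admissibility polytopes: $A\in\mathbb{R}^{r\times n}$ is a fixed matrix such that, for all $\ell^\pm\in\mathbb{R}^r_+$, the set $\mathcal{A}(\ell)=\{\tilde x\in\mathbb{R}^n : -\ell^-\le A\tilde x\le \ell^+\}$ is a polytope (in particular bounded). The vectors $\ell_x^{\max,\pm}\in\mathbb{R}^r_+$ are given and encode linear feasibility constraints. Residual: $\delta_2 f(x)=f(x)-f(x^\star)-\frac{\partial f}{\partial x}\big|_{x^\star}(x-x^\star)$. Nonlinear bounds: $\delta_2 f^\pm(\ell)\in\mathbb{R}^m$ are given functions of $\ell=(\ell^-,\ell^+)$ such that for every $\ell^\pm\in\mathbb{R}^r_+$ and every $\tilde x\in\mathcal{A}(\ell)$ one has $-\delta_2 f^-(\ell)\le \delta_2 f(x^\star+\tilde x)\le \delta_2 f^+(\ell)$ componentwise. Matrices: $B=AJ_\star^{-1}R$, $C=-AJ_\star^{-1}M$, $D=TLJ_\star^{-1}R$, $E=T-TLJ_\star^{-1}M$.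 For any matrix $F$, $F^+$ and $F^-$ denote the absolute values of its positive and negative parts, so $F=F^+-F^-$ with $F^\pm_{ij}\ge 0$. *)

(* Defs.v *)
From mathcomp Require Import all_boot all_order all_algebra.
From mathcomp Require Import all_classical all_reals all_analysis.

Set Implicit Arguments.
Unset Strict Implicit.
Unset Printing Implicit Defensive.

Import Order.TTheory GRing.Theory Num.Theory.
Import numFieldNormedType.Exports.

Local Open Scope classical_set_scope.
Local Open Scope ring_scope.

(* Componentwise order; matrices carry no canonical order in MathComp. *)
Definition mxle (K : realType) (m n : nat) (u v : 'M[K]_(m, n)) : Prop :=
  forall i j, u i j <= v i j.

Notation "u <=m v" := (mxle u v) (at level 70, no associativity).
Notation "u <=m v <=m w" := (mxle u v /\ mxle v w)
  (at level 70, v at next level, no associativity).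

Definition pospart (K : realType) (m n : nat) (F : 'M[K]_(m, n)) :
    'M[K]_(m, n) :=
  map_mx (fun a => Num.max a 0) F.

Definition negpart (K : realType) (m n : nat) (F : 'M[K]_(m, n)) :
    'M[K]_(m, n) :=
  map_mx (fun a => Num.max (- a) 0) F.

Lemma posnegpartE (K : realType) (m n : nat) (F : 'M[K]_(m, n)) :
  F = pospart F - negpart F.
Proof.
apply/matrixP => i j; rewrite !mxE.
case: (leP (F i j) 0) => [F_le0 | /ltW F_ge0].
  by rewrite max_l ?oppr_ge0// sub0r opprK.
by rewrite max_r ?oppr_le0// subr0.
Qed.

(* The library's ['J f p] acts on row vectors; this is the usual m x n matrix of
   partial derivatives, acting on column vectors on the left. *)
Definition jac (K : realType) (n m : nat) (f : 'cV[K]_n -> 'cV[K]_m)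
    (x : 'cV[K]_n) : 'M[K]_(m, n) :=
  \matrix_(i < m, j < n) ('D_(delta_mx j 0) f x) i 0.

Lemma diff_jac (K : realType) (n m : nat) (f : 'cV[K]_n -> 'cV[K]_m)
    (x v : 'cV[K]_n) : differentiable f x -> 'd f x v = jac f x *m v.
Proof.
move=> df; apply/matrixP => i j; rewrite ord1 {1}(matrix_sum_delta v).
rewrite linear_sum summxE !mxE; apply: eq_bigr => k _.
by rewrite big_ord1 linearZ !mxE deriveE// mulrC.
Qed.

(* Second-order residual of [f] at [x0]. *)
Definition delta2 (K : realType) (n m : nat) (f : 'cV[K]_n -> 'cV[K]_m)
    (x0 x : 'cV[K]_n) : 'cV[K]_m :=
  f x - f x0 - jac f x0 *m (x - x0).

(* A polytope is a bounded intersection of finitely many closed half-spaces. *)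
Definition is_polytope (K : realType) (n : nat) (S : set 'cV[K]_n) : Prop :=
  (exists (p : nat) (G : 'M[K]_(p, n)) (g : 'cV[K]_p),
     S = [set x | G *m x <=m g]) /\ bounded_set S.

(* A bound [l] is the pair (l^-, l^+). *)
Definition admissible (K : realType) (n r : nat) (A : 'M[K]_(r, n))
    (l : 'cV[K]_r * 'cV[K]_r) : set 'cV[K]_n :=
  [set x | - l.1 <=m A *m x <=m l.2].

(* Main.v *)
Require Import Defs.
From mathcomp Require Import all_boot all_order all_algebra finmap.
From mathcomp Require Import all_classical all_reals all_analysis.
From mathcomp Require Import zify lra ring.

Set Implicit Arguments.
Unset Strict Implicit.
Unset Printing Implicit Defensive.

Import Order.TTheory GRing.Theory Num.Theory.
Import numFieldNormedType.Exports.

(** Writing [x = xs + z] and [d z] for the residual at [x], the equation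
    [M f(x) = M f(xs) + R (u - us)] says that [z] is a fixed point of
    [G z = J^-1 (R (u - us) - M (d z))].  The self-consistency constraints on
    [lx] say that [G] maps the polytope [admissible A lx] into itself, so
    Schauder's theorem for compact convex sets provides [z]; the bound on [h]
    follows from [h(x) = h(xs) + D (u - us) + E (d z)].

    Schauder's theorem is obtained from Scarf's lemma on dominant sets, used in
    place of Sperner's lemma because it needs no triangulation: it applies
    directly to the grid points of the simplex spanned by a finite net. *)

(** * Scarf's lemma *)

Lemma subset_cardS (T : finType) (A B : {set T}) :
  A \subset B -> #|A|.+1 = #|B| -> exists2 x, x \notin A & B = x |: A.
Proof.
move=> AB cAB; have /cards1P[x BAx] : #|B :\: A| == 1.
  by rewrite cardsDS// -cAB subSnn.
have : x \in B :\: A by rewrite BAx set11.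
rewrite inE => /andP[xA xB]; exists x => //.
by rewrite -BAx finset.setUC -[LHS](finset.setID B A) (finset.setIidPr AB).
Qed.

Section Scarf.
Variables (V I : finType) (u : I -> V -> nat) (s : I -> V) (c : V -> I).
Hypothesis u_inj : forall i, injective (u i).
Hypothesis c_slack : cancel s c.
(* The slack [s i] stands for the facet of the simplex on which the [i]-th
   coordinate vanishes: it is least for the order [i] and lies above all grid
   points for the other orders. *)
Hypothesis slack_min : forall i v, u i (s i) <= u i v.
Hypothesis slack_max :
  forall i j v, v \notin codom s -> i != j -> u j v < u j (s i).
Variables (v0 : V) (i0 : I).
Hypothesis v0_grid : v0 \notin codom s.

(** Scarf's dominant sets: for nonempty [Z], no [y] lies strictly above the [i]-least element of [Z]
    for all orders [i] at once. *)
Definition dominant (Z : {set V}) :=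
  [forall y, exists i, forall z in Z, u i y <= u i z].

Lemma dominantP (Z : {set V}) :
  reflect (forall y, exists i, forall z, z \in Z -> u i y <= u i z)
          (dominant Z).
Proof.
apply: (iffP forallP) => H y; have := H y.
  by move=> /existsP[i /forall_inP ?]; exists i.
by move=> [i ?]; apply/existsP; exists i; apply/forall_inP.
Qed.

Lemma dominant_sub (W Z : {set V}) : W \subset Z -> dominant Z -> dominant W.
Proof.
move=> /fintype.subsetP WZ /dominantP domZ; apply/dominantP => y.
by have [i iy] := domZ y; exists i => z /WZ; exact: iy.
Qed.

(** Cells play the part of the full-dimensional simplices of a triangulation, doors that of the
    facets carrying every colour except [i0]. *)
Definition cell (Z : {set V}) := dominant Z && (#|Z| == #|I|).

Definition door (W : {set V}) :=
  [&& dominant W, #|W|.+1 == #|I| & c @: W == [set~ i0]].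

Definition slack_door := s @: [set~ i0].

Let s_inj : injective s := can_inj c_slack.

Lemma card_setC1 (i : I) : #|[set~ i]%SET|.+1 = #|I|.
Proof. by rewrite cardsC1 prednK//; apply/card_gt0P; exists i. Qed.

(** A slack is least in its own order, while in order [i0] a grid point lies below every slack other
    than [s i0]. *)
Lemma door_slack_door : door slack_door.
Proof.
apply/and3P; split.
- apply/dominantP => y; have [/codomP[j ->]|y_grid] := boolP (y \in codom s).
    by exists j => z _; exact: slack_min.
  exists i0 => z /imsetP[i]; rewrite !inE => ii0 ->.
  exact/ltnW/slack_max.
- by rewrite card_imset// card_setC1.
- by rewrite -imset_comp (eq_imset _ c_slack) imset_id.
Qed.

(** The slack [s i] has colour [i], so a set of slacks is determined by its colours. *)
Lemma door_subslackE (W : {set V}) :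
  door W -> (forall x, x \in W -> x \in codom s) -> W = slack_door.
Proof.
move=> /and3P[_ _ /eqP cW] Ws; rewrite /slack_door -cW -imset_comp.
rewrite -[LHS](imset_id W); apply: eq_in_imset => x /Ws /codomP[i ->] /=.
by rewrite c_slack.
Qed.

(* For a cell with [c @: Z = [set~ i0]], the two points sharing a colour can be
   removed; if [c @: Z] is everything, only the point of colour [i0] can. *)
Lemma odd_doors (Z : {set V}) : cell Z ->
  odd #|[set W | door W & W \subset Z]| = (c @: Z == [set: I]).
Proof.
move=> /andP[domZ /eqP cardZ].
have -> : [set W | door W & W \subset Z] =
    (fun z => Z :\ z) @: [set z in Z | c @: (Z :\ z) == [set~ i0]].
  apply/setP => W; rewrite inE; apply/andP/imsetP.
    move=> [/and3P[domW /eqP cardW cW] WZ].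
    have [|z zW ZE] := subset_cardS WZ; first by rewrite cardW cardZ.
    by exists z; rewrite ?inE ZE setU1K// setU11 cW.
  move=> [z]; rewrite inE => /andP[zZ cz ->]; split; last exact: subD1set.
  rewrite /door cz (dominant_sub _ domZ) ?subD1set//=.
  by rewrite andbT -cardZ (cardsD1 z Z) zZ.
rewrite card_in_imset; last first.
  move=> x y; rewrite !inE => /andP[xZ _] /andP[yZ _] E.
  have : x \notin Z :\ y by rewrite -E !inE eqxx.
  by rewrite !inE xZ andbT negbK => /eqP.
have [cZ|cZ] := eqVneq (c @: Z) [set: I].
  have cinj : {in Z &, injective c}.
    by apply/imset_injP; rewrite cZ cardsT cardZ.
  have /imsetP[z zZ i0z] : i0 \in c @: Z by rewrite cZ inE.
  suff -> : [set z in Z | c @: (Z :\ z) == [set~ i0]] = [set z].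
    by rewrite cards1.
  apply/setP => x; rewrite !inE; apply/andP/eqP => [[xZ /eqP cx]|->].
    have [cxi0|] := eqVneq (c x) i0; first by apply: cinj => //; rewrite cxi0.
    move=> cxi0; have : c x \in c @: (Z :\ x) by rewrite cx !inE.
    move=> /imsetP[y]; rewrite !inE => /andP[yx yZ] /cinj.
    by move=> /(_ xZ yZ) xy; rewrite xy eqxx in yx.
  split=> //; apply/eqP/setP => i; rewrite !inE; apply/imsetP/idP.
    move=> [y]; rewrite !inE => /andP[yz yZ ->]; apply: contra yz => /eqP.
    by rewrite i0z => /cinj ->.
  move=> ii0; have /imsetP[y yZ iy] : i \in c @: Z by rewrite cZ inE.
  exists y => //; rewrite !inE yZ andbT; apply: contra ii0 => /eqP yz.
  by rewrite iy yz -i0z.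
set S := [set z in Z | _].
have [->|[z1]] := set_0Vmem S; first by rewrite cards0.
rewrite inE => /andP[z1Z /eqP cz1].
have cinj : {in Z :\ z1 &, injective c}.
  apply/imset_injP; rewrite cz1; apply/eqP; apply: succn_inj.
  by rewrite card_setC1 -cardZ (cardsD1 z1 Z) z1Z.
(* Otherwise [z1] would supply the one missing colour, and [Z] would be fully coloured. *)
have cz1i0 : c z1 != i0.
  apply: contra cZ => /eqP cz1i0; apply/eqP/setP => i; rewrite inE.
  have [->|ii0] := eqVneq i i0; first by rewrite -cz1i0 imset_f.
  have /imsetP[y] : i \in c @: (Z :\ z1) by rewrite cz1 !inE.
  by rewrite !inE => /andP[_ yZ] ->; rewrite imset_f.
have /imsetP[z2 z2Z cz12] : c z1 \in c @: (Z :\ z1) by rewrite cz1 !inE.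
have := z2Z; rewrite !inE => /andP[z21 z2Z'].
suff -> : S = [set z1; z2] by rewrite cards2 eq_sym z21.
apply/setP => z; rewrite !inE; apply/andP/orP.
  move=> [zZ /eqP cz]; have [|zz1] := eqVneq z z1; first by left.
  right; apply/eqP/cinj => //; first by rewrite !inE zz1.
  have : c z \in c @: (Z :\ z).
    by rewrite cz -cz1 imset_f// !inE zz1.
  move=> /imsetP[y]; rewrite !inE => /andP[yz yZ] czy.
  have [yz1|yz1] := eqVneq y z1; first by rewrite czy yz1.
  have yEz : y = z by apply: cinj; rewrite // !inE ?yz1 ?zz1.
  by rewrite yEz eqxx in yz.
move=> [/eqP->|/eqP->]; first by rewrite cz1 eqxx.
split=> //; rewrite -cz1; apply/eqP/setP => i; apply/imsetP/imsetP.
  move=> [y]; rewrite !inE => /andP[yz2 yZ] ->.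
  have [->|yz1] := eqVneq y z1; first by exists z2.
  by exists y; rewrite // !inE yz1.
move=> [y]; rewrite !inE => /andP[yz1 yZ] ->.
have [->|yz2] := eqVneq y z2; last by exists y; rewrite // !inE yz2.
by exists z1; rewrite // !inE eq_sym z21.
Qed.

(** Exactly one cell contains [slack_door]: the one obtained by adding the [i0]-greatest point
    outside it. *)
Lemma odd_cells_slack_door :
  odd #|[set Z | cell Z & slack_door \subset Z]|.
Proof.
have [y yW ymax] : exists2 y, y \notin slack_door &
    forall z, z \notin slack_door -> u i0 z <= u i0 y.
  have si0W : s i0 \notin slack_door.
    apply/imsetP => -[i]; rewrite !inE => ii0 /s_inj ii.
    by rewrite ii eqxx in ii0.
  by exists [arg max_(y > s i0 | y \notin slack_door) u i0 y];
    case: arg_maxnP.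
have v0W : v0 \notin slack_door.
  by apply: contra v0_grid => /imsetP[i _ ->]; exact: codom_f.
(* The only slack outside [slack_door] is [s i0], which is least in order [i0] and so cannot be the
   maximum in the presence of [v0]. *)
have y_grid : y \notin codom s.
  apply/negP => /codomP[i yE].
  have ii0 : i = i0.
    apply/eqP; apply: contraNT yW => ii0.
    by rewrite yE imset_f// !inE.
  have v0E : v0 = y.
    apply: (@u_inj i0); apply/eqP; rewrite eqn_leq ymax//= yE ii0.
    exact: slack_min.
  by move: v0_grid; rewrite v0E yE codom_f.
have /and3P[_ /eqP card_door _] := door_slack_door.
suff -> : [set Z | cell Z & slack_door \subset Z] = [set y |: slack_door].
  by rewrite cards1.
apply/setP => Z; rewrite !inE; apply/andP/eqP; last first.
  move=> ->; split; last exact: finset.subsetUr.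
  rewrite /cell cardsU1 yW add1n card_door eqxx andbT.
  apply/dominantP => v; have [/imsetP[j ji0 ->]|vW] := boolP (v \in slack_door).
    by exists j => z _; exact: slack_min.
  exists i0 => z; rewrite !inE => /predU1P[->|]; first exact: ymax.
  move=> /imsetP[j]; rewrite !inE => ji0 ->.
  by apply: leq_trans (ymax _ vW) _; exact/ltnW/slack_max.
move=> [/andP[/dominantP domZ /eqP cardZ] WZ].
have [|z zW ZE] := subset_cardS WZ; first by rewrite card_door.
rewrite ZE; congr (_ |: _); apply/eqP; apply/negPn/negP => zy.
have [i iy] := domZ y.
have [ii0|ii0] := eqVneq i i0.
  have : u i0 y <= u i0 z by rewrite -ii0 iy// ZE setU11.
  have := ymax _ zW; rewrite leq_eqVlt => /predU1P[/u_inj zE|].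
    by rewrite zE eqxx in zy.
  by rewrite ltnNge => /negP.
have yi : u i y <= u i (s i) by rewrite iy// ZE !inE imset_f ?orbT// !inE.
have /eqP/u_inj yE : u i y == u i (s i) by rewrite eqn_leq yi slack_min.
by move: y_grid; rewrite yE codom_f.
Qed.

(* Exactly one point of [W] is least for two orders [i1] and [i2].  There are two
   cells containing [W]: for [i] in [{i1, i2}], add the [i]-greatest point among
   those above the [j]-minimum of [W] for all [j != i]. *)
Lemma even_cells_door (W : {set V}) : door W -> W != slack_door ->
  ~~ odd #|[set Z | cell Z & W \subset Z]|.
Proof.
move=> doorW WW0; have /and3P[/dominantP domW /eqP cardW _] := doorW.
have [x xW x_grid] : exists2 x, x \in W & x \notin codom s.
  apply/exists_inP; apply: contraNT WW0 => /exists_inPn W_slack.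
  by apply/eqP/door_subslackE => // y /W_slack; rewrite negbK.
pose mu i := [arg min_(w < x in W) u i w].
have muW i : mu i \in W by rewrite /mu; case: arg_minnP.
have mu_le i w : w \in W -> u i (mu i) <= u i w.
  by rewrite /mu; case: arg_minnP => // ? _; exact.
have mu_eq i w : w \in W -> (forall z, z \in W -> u i w <= u i z) -> mu i = w.
  move=> wW w_le; apply: (@u_inj i); apply/eqP.
  by rewrite eqn_leq mu_le//= w_le.
(* Pigeonhole: [W] has one element fewer than there are orders. *)
have [i1 [i2 [i12 mu12]]] : exists i1 i2, i1 != i2 /\ mu i1 = mu i2.
  have [/injectiveP mu_inj|/injectivePn[i1 [i2 i12 mu12]]] :=
    boolP (injectiveb mu).
    suff : #|I| <= #|W| by rewrite -cardW ltnn.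
    rewrite -cardsT -(card_imset _ mu_inj); apply: subset_leq_card.
    by apply/fintype.subsetP => _ /imsetP[i _ ->].
  by exists i1, i2.
have imW i : (forall w, w \in W -> exists2 j, j != i & mu j = w) ->
    {in [set~ i] &, injective mu}.
  move=> mu_onto; apply/imset_injP; rewrite eqn_leq leq_imset_card/=.
  rewrite -ltnS card_setC1 -cardW ltnS; apply: subset_leq_card.
  apply/fintype.subsetP => w /mu_onto[j ji <-].
  by rewrite imset_f// !inE.
have mu_onto w : w \in W -> exists i, mu i = w.
  by move=> wW; have [i iw] := domW w; exists i; exact: mu_eq.
have onto1 w : w \in W -> exists2 j, j != i1 & mu j = w.
  move=> /mu_onto[i muiw]; have [ii1|] := eqVneq i i1; last by exists i.
  by exists i2; rewrite 1?eq_sym// -mu12 -ii1.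
have onto2 w : w \in W -> exists2 j, j != i2 & mu j = w.
  move=> /mu_onto[i muiw]; have [ii2|] := eqVneq i i2; last by exists i.
  by exists i1; rewrite // mu12 -ii2.
pose Y i := [set y | [forall (j | j != i), u j (mu j) < u j y]].
have YP i y : reflect (forall j, j != i -> u j (mu j) < u j y) (y \in Y i).
  by rewrite inE; exact: forall_inP.
have sY i : s i \in Y i.
  apply/YP => j ji; apply: leq_ltn_trans (mu_le j x xW) _.
  by apply: slack_max => //; rewrite eq_sym.
pose top i := [arg max_(y > s i in Y i) u i y].
have topY i : top i \in Y i by rewrite /top; case: arg_maxnP.
have top_max i y : y \in Y i -> u i y <= u i (top i).
  by rewrite /top; case: arg_maxnP => // ? _; exact.
(* Some order puts [y] below all of [W], and membership in [Y i] excludes every order but [i]. *)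
have Y_le i y : y \in Y i -> forall z, z \in W -> u i y <= u i z.
  move=> /YP yY; have [j jy] := domW y.
  have [<-//|/yY] := eqVneq j i.
  by rewrite ltnNge jy.
have Y_notin i y : (forall w, w \in W -> exists2 j, j != i & mu j = w) ->
    y \in Y i -> y \notin W.
  by move=> onto /YP yY; apply/negP => /onto[j /yY + muj]; rewrite muj ltnn.
have cell_top i : (forall w, w \in W -> exists2 j, j != i & mu j = w) ->
    cell (top i |: W).
  move=> onto; rewrite /cell cardsU1 (Y_notin i)// add1n cardW eqxx andbT.
  apply/dominantP => v; have [vY|/YP vY] := boolP (v \in Y i).
    exists i => z; rewrite !inE => /predU1P[->|]; first exact: top_max.
    exact: Y_le.
  have /existsP[j /andP[ji vj]] : [exists j, (j != i) && (u j v <= u j (mu j))].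
    apply: contra_notT vY => /existsPn vY j ji.
    by have := vY j; rewrite ji/= -ltnNge.
  exists j => z; rewrite !inE => /predU1P[->|/(mu_le j)]; last exact: leq_trans.
  by apply: leq_trans vj _; apply: ltnW; exact: (YP _ _ (topY i)).
suff -> : [set Z | cell Z & W \subset Z] = [set top i1 |: W; top i2 |: W].
  rewrite cards2; suff -> : top i1 |: W != top i2 |: W by [].
  apply/eqP => topE; have : top i1 \in top i2 |: W by rewrite -topE setU11.
  rewrite !inE (negPf (Y_notin i1 _ _ _))// orbF => /eqP top12.
  have [j jt] := domW (top i1); have := jt _ (muW j).
  apply/negP; rewrite -ltnNge.
  have [ji1|ji1] := eqVneq j i1; last exact: (YP _ _ (topY i1)).
  by rewrite top12; apply: (YP _ _ (topY i2)); rewrite ji1.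
apply/setP => Z; rewrite !inE; apply/andP/orP; last first.
  by case=> /eqP ->; rewrite finset.subsetUr cell_top.
move=> [/andP[/dominantP domZ /eqP cardZ] WZ].
have [|z zW ZE] := subset_cardS WZ; first by rewrite cardW.
have zZ : z \in Z by rewrite ZE setU11.
have {}WZ w : w \in W -> w \in Z by move=> wW; rewrite ZE !inE wW orbT.
have [i iz] := domZ z.
have lt_iz w : w \in W -> u i z < u i w.
  move=> wW; rewrite ltn_neqAle iz ?WZ// andbT; apply/negP => /eqP/u_inj zw.
  by rewrite zw wW in zW.
(* Order [i] puts [z] strictly below [W], so the order witnessing dominance of [Z] at [w] cannot be
   [i]. *)
have onto w : w \in W ->
    exists j, [/\ j != i, mu j = w & forall z', z' \in Z -> u j w <= u j z'].
  move=> wW; have [j jw] := domZ w; exists j; split => //.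
    apply: contraTN (jw _ zZ) => /eqP ->; rewrite -ltnNge; exact: lt_iz.
  by apply: mu_eq => // z' z'W; apply: jw; exact: WZ.
have inj_i : {in [set~ i] &, injective mu}.
  by apply: imW => w /onto[j [ji muj _]]; exists j.
suff zE : z = top i.
  (* If [i] were neither, [mu] would be injective on a set containing both [i1] and [i2]. *)
  have : (i == i1) || (i == i2).
    apply/negPn/negP; rewrite negb_or => /andP[ii1 ii2].
    suff i1i2 : i1 = i2 by rewrite i1i2 eqxx in i12.
    by apply: inj_i; rewrite // !inE eq_sym.
  by case/orP => /eqP iE; [left|right]; rewrite ZE zE iE.
have zY : z \in Y i.
  apply/YP => j ji; rewrite ltnNge; apply/negP => zj.
  have [j' [j'i muj' lej']] := onto _ (muW j).
  have jj' : j' = j by apply: inj_i; rewrite // !inE.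
  have := lej' _ zZ; rewrite jj' => muz.
  have /eqP/u_inj zE : u j z == u j (mu j) by rewrite eqn_leq zj.
  by move: zW; rewrite zE muW.
apply: (@u_inj i); apply/eqP; rewrite eqn_leq top_max//=.
have [j jt] := domZ (top i); have [ji|ji] := eqVneq j i.
  by rewrite -{1 3}ji jt.
by have := YP _ _ (topY i) _ ji; rewrite ltnNge jt// WZ.
Qed.

(** Incidences of a door in a cell are counted twice. Summed over doors, only [slack_door]
    contributes an odd number, so the total is odd. Summed over cells, only the fully coloured ones
    contribute an odd number, so at least one exists. *)
Lemma scarf : exists Z, dominant Z /\ c @: Z = [set: I].
Proof.
have : odd (\sum_(W | door W) #|[set Z | cell Z & W \subset Z]|).
  rewrite (bigD1 slack_door) ?door_slack_door//= oddD odd_cells_slack_door.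
  elim/big_rec : _ => // W n /andP[doorW WW0] IH.
  by rewrite oddD (negPf (even_cells_door _ _)).
under eq_bigr => W _ do rewrite -sum1dep_card.
rewrite (exchange_big_dep cell)/=; last by move=> ? ? _ /andP[].
move=> odd_sum.
have [Z [cellZ cZ]] : exists Z, cell Z /\ c @: Z = [set: I].
  apply: contraPP odd_sum => noZ; apply/negP.
  elim/big_rec : _ => // Z n cellZ IH; rewrite oddD (negPf IH) addbF.
  have := odd_doors cellZ; rewrite -sum1dep_card.
  rewrite [in X in _ -> X](eq_bigl (fun W => door W && (W \subset Z)))
    => [->|W].
    by apply/eqP => cZ; apply: noZ; exists Z.
  by rewrite cellZ.
by exists Z; move: cellZ => /andP[].
Qed.
End Scarf.

(** * Scarf's lemma on the grid of a simplex *)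

Section Grid.
Variables (I : finType) (q : nat) (c : {ffun I -> 'I_q.+1} -> I) (i0 : I).

Let grid := {a : {ffun I -> 'I_q.+1} | \sum_i a i == q}.

(* Grid points are compared by their [i]-th coordinate, ties being broken by
   [enum_rank]. *)
Let u (i : I) (v : grid + I) : nat :=
  match v with
  | inl a => (val a i * #|{: grid}| + enum_rank a).+1
  | inr j => if j == i then 0 else (q.+1 * #|{: grid}| + enum_rank j).+1
  end.

Let u_inl_lt i (a : grid) : u i (inl a) <= q.+1 * #|{: grid}|.
Proof.
have := ltn_ord (enum_rank a) => rM; rewrite /u.
have : val a i * #|{: grid}| + #|{: grid}| <= q.+1 * #|{: grid}|.
  by rewrite -mulSnr leq_mul2r ltn_ord orbT.
by apply: leq_trans; rewrite -addnS leq_add2l.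
Qed.

Let u_inj i : injective (u i).
Proof.
move=> [a|j] [b|k] ukj; move: (ukj); rewrite {1 2}/u.
- move=> [ab]; congr inl; apply/enum_rank_inj/val_inj => /=.
  (* Reduction modulo the number of grid points recovers the rank. *)
  by have := congr1 (modn ^~ #|{: grid}|) ab; rewrite /= !modnMDl !modn_small.
- by have := u_inl_lt i a; rewrite /u; case: eqP => //; lia.
- by have := u_inl_lt i b; rewrite /u; case: eqP => //; lia.
- case: (eqVneq j i) => [->|_]; case: (eqVneq k i) => [->|_] // -[jk].
  by congr inr; apply/enum_rank_inj/val_inj => /=; lia.
Qed.

Let col (v : grid + I) := match v with inl a => c (val a) | inr j => j end.

Let gridP (f : I -> nat) : \sum_i f i = q -> 
  exists a : grid, forall i, val a i = f i :> nat.
Proof.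
(* No term exceeds the total [q], so [inord] leaves the values unchanged. *)
move=> fq; have fE i : @inord q (f i) = f i :> nat.
  by rewrite inordK// ltnS -fq (bigD1 i)//= leq_addr.
have aq : \sum_i [ffun i => @inord q (f i)] i == q.
  by rewrite -[eqbRHS]fq; apply/eqP/eq_bigr => i _; rewrite ffunE fE.
by exists (Sub [ffun i => @inord q (f i)] aq : grid) => i; rewrite /= ffunE fE.
Qed.

(* A dominant set only involves points [a] with [m <= a] where, no grid point
   being strictly above [m] on [C], [\sum_(i in C) (m i).+1 > q]; hence [a] and
   [m] are within [#|I|] of each other. *)
Lemma sperner_grid : exists (C : {set I}) (m : I -> nat),
  [/\ C != finset.set0, forall j, j \notin C -> m j = 0 &
      forall i, i \in C -> exists a : {ffun I -> 'I_q.+1},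
        [/\ \sum_j a j = q, c a = i & forall j, m j <= a j <= m j + #|I|]].
Proof.
(* The grid point [v0] is the vertex of the simplex belonging to [i0]. *)
have [v0 _] : exists a : grid, forall i, val a i = (i == i0) * q :> nat.
  apply: gridP; rewrite (bigD1 i0)//= eqxx mul1n big1 ?addn0// => j /negPf ->.
  by rewrite mul0n.
have [Z [/dominantP domZ colZ]] : exists Z, dominant u Z /\ col @: Z = [set: I].
  apply: (@scarf _ _ u inr col u_inj _ _ _ (inl v0) i0) => //.
  - by move=> i [a|j]; rewrite /u eqxx.
  - move=> i j [a|k] /negP; last by case; exact: codom_f.
    by move=> _ ij; have := u_inl_lt j a; rewrite /= (negPf ij); lia.
  - by apply/negP => /codomP[].
(* If [inr i] is in [Z], its value [0] in order [i] is below every grid point; only the orders in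
   [C] can witness dominance at a grid point. *)
pose C : {set I} := [set i | inr i \notin Z]%SET.
have domC (a : grid) : exists2 i, i \in C &
    forall b : grid, inl b \in Z -> val a i <= val b i.
  have [i ai] := domZ (inl a); exists i.
    by rewrite inE; apply/negP => /ai; rewrite /u eqxx.
  move=> b /ai; rewrite /u ltnS leqNgt => ab.
  rewrite leqNgt; apply: contra ab => ba.
  have := leq_mul ba (leqnn #|{: grid}|); rewrite mulSnr => bM.
  apply: leq_trans (leq_trans bM (leq_addr _ _)).
  by rewrite -addnS leq_add2l ltn_ord.
have colC i : i \in C -> exists2 a : grid, inl a \in Z & c (val a) = i.
  move=> iC; have : i \in col @: Z by rewrite colZ inE.
  case/imsetP => -[a|j] aZ iE; first by exists a.
  by move: iC; rewrite inE iE aZ.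
have [i1 i1C _] := domC v0.
have [a1 a1Z _] := colC _ i1C.
pose amin j := [arg min_(a < a1 | inl a \in Z) val a j].
pose m j := if j \in C then val (val (amin j) j) else 0.
have m_le j (a : grid) : inl a \in Z -> m j <= val a j.
  by rewrite /m /amin; case: ifP => // _; case: arg_minnP => // b _; exact.
have sum_m : q < \sum_(i in C) (m i).+1.
  rewrite ltnNge; apply/negP => le_q.
  (* [f] exceeds [m] by one on [C], and the surplus goes to the coordinate [i1] to bring the total
     up to [q]. *)
  pose f j :=
    if j \in C then (m j).+1 + (j == i1) * (q - \sum_(i in C) (m i).+1) else 0.
  have [|y yE] := @gridP f.
    rewrite /f -big_mkcond/= big_split/= [X in _ + X](bigD1 i1)//= eqxx mul1n.
    rewrite [X in _ + (_ + X)]big1 ?addn0 ?subnKC// => j /andP[_ /negPf ->].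
    by rewrite mul0n.
  have [i iC iy] := domC y.
  have : inl (amin i) \in Z by rewrite /amin; case: arg_minnP.
  by move=> /iy; rewrite yE /f iC /m iC addSn ltnNge leq_addr.
exists C, m; split.
- by apply/finset.set0Pn; exists i1.
- by move=> j /negPf jC; rewrite /m jC.
move=> i /colC[a aZ ca]; exists (val a); split => //; first exact/eqP/(valP a).
move=> j; rewrite m_le//=.
have /eqP := valP a; rewrite (bigID (fun i => i \in C))/= => sum_a.
have cardC : #|C| <= #|I| := max_card _.
have sumS : \sum_(i in C) (m i).+1 = \sum_(i in C) m i + #|C|.
  by rewrite -sum1_card -big_split/=; apply: eq_bigr => k _; rewrite addn1.
(* Here [x] and [t] are the [j]-th coordinates of [a] and [m], [y] and [y'] their sums over [C]
   (without [j]), [z] the remaining coordinates of [a], and [d] and [e] the cardinals of [C] and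
   [I]. *)
have arith (x y y' z t d e : nat) :
  x + y + z = q -> q < t + y' + d -> y' <= y -> d <= e -> x <= t + e.
  by clear; lia.
have [jC|jC] := boolP (j \in C).
  have : \sum_(k in C | k != j) m k <= \sum_(k in C | k != j) val a k.
    by apply: leq_sum => k _; exact: m_le.
  have splitC F : \sum_(k in C) F k = F j + \sum_(k in C | k != j) F k.
    exact: bigD1.
  move=> le_sum; move: sum_a sum_m; rewrite sumS !splitC => sum_a sum_m.
  exact: arith sum_a sum_m le_sum cardC.
have : \sum_(k in C) m k <= \sum_(k in C) val a k.
  by apply: leq_sum => k _; exact: m_le.
move=> le_sum; move: sum_a sum_m; rewrite sumS [X in _ + X](bigD1 j)//=.
rewrite addnA [_ + val a j]addnC => sum_a sum_m.
apply: arith sum_a _ le_sum cardC; apply: leq_trans sum_m _.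
by rewrite -addnA leq_addl.
Qed.
End Grid.

(** * Schauder's fixed point theorem for compact convex sets *)

Local Open Scope classical_set_scope.
Local Open Scope ring_scope.

(** Induction on partial sums, with the invariant that a partial sum divided by its total weight
    lies in [S]. A zero total is kept as a separate alternative, in which the partial sum itself
    vanishes. *)
Lemma convex_set_sum (K : realType) (V : lmodType K)
    (S : set (convex_lmodType V)) (I : finType) (w : I -> K) (p : I -> V) :
  convex_set S -> (forall i, 0 <= w i) -> (forall i, S (p i)) ->
  \sum_i w i = 1 -> S (\sum_i w i *: p i).
Proof.
move=> cS w_ge0 pS sum_w.
have [_ _] : [/\ 0 <= \sum_i w i, \sum_i w i = 0 -> \sum_i w i *: p i = 0 &
    \sum_i w i = 0 \/ S ((\sum_i w i)^-1 *: (\sum_i w i *: p i))].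
  elim/big_rec2 : _ => [|i v W _ [W_ge0 Wv WS]]; first by split=> //; left.
  have [w0|w_gt0] := eqVneq (w i) 0.
    by rewrite w0 scale0r !add0r.
  have {}w_gt0 : 0 < w i by rewrite lt_neqAle eq_sym w_gt0 w_ge0.
  have wW_gt0 : 0 < w i + W by rewrite ltr_pwDl.
  split; [exact: ltW|by move/eqP; rewrite gt_eqF|right].
  have [W0|W_neq0] := eqVneq W 0.
    by rewrite W0 Wv// !addr0 scalerA mulVf ?gt_eqF// scale1r.
  have {}WS : S (W^-1 *: v) by case: WS => // /eqP; rewrite (negPf W_neq0).
  (* This is the share of [p i] in the new total; the share [W / (w i + W)] falls to the previous
     normalised sum. *)
  have t01 : 0 <= w i / (w i + W) <= 1.
    by rewrite divr_ge0 ?(ltW wW_gt0)//= ler_pdivrMr// mul1r lerDl.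
  pose t : {i01 K} := Itv01 (andP t01).1 (andP t01).2.
  have := cS (p i) (W^-1 *: v) t; rewrite !inE => /(_ (pS i) WS).
  congr (S _); rewrite /conv/= scalerDr !scalerA; congr (_ *: _ + _ *: _).
    by rewrite mulrC.
  rewrite -[LHS]/((1 - w i / (w i + W)) / W).
  rewrite -[X in X - _](mulfV (lt0r_neq0 wW_gt0)) -mulrBl addrAC subrr add0r.
  by rewrite mulrAC mulfV ?mul1r.
by rewrite sum_w invr1 scale1r => -[/eqP|//]; rewrite oner_eq0.
Qed.

Section Schauder.
Variables (K : realType) (V : normedModType K) (S : set V) (g : V -> V).
Hypothesis S_compact : compact S.
Hypothesis g_cont : {within S, continuous g}.

(** Compactness, in its near-covering form, turns a [d] valid around each point into a single [d]
    for all of [S]. *)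
Lemma heine_cantor (e : K) : 0 < e -> exists2 d, 0 < d &
  forall x y, S x -> S y -> `|x - y| < d -> `|g x - g y| < e.
Proof.
move=> e_gt0; have e2_gt0 : 0 < e / 2 by rewrite divr_gt0.
pose P d x := S x -> forall y, S y -> `|x - y| < d -> `|g x - g y| < e.
have : \forall d \near 0^'+, S `<=` P d.
  move/compact_near_coveringP : S_compact; apply => x xS.
  have /cvgrPdist_lt/(_ _ e2_gt0) := (subspace_continuousP S g).1 g_cont x xS.
  rewrite /within/= => /nbhs_ballP[r /= r_gt0 gr].
  have r2_gt0 : 0 < r / 2 by rewrite divr_gt0.
  near=> x' d => x'S y yS x'y.
  have xx' : `|x - x'| < r / 2.
    near: x'; have := nbhsx_ballx x _ r2_gt0.
    by apply: filterS => z; rewrite -ball_normE.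
  have dr : d < r / 2 by near: d; exact: nbhs_right_lt.
  have gxx' : `|g x - g x'| < e / 2.
    apply: gr; rewrite // -ball_normE/= (lt_trans xx')//.
    by rewrite gtr_pMr// invf_lt1// ltr1n.
  have gxy : `|g x - g y| < e / 2.
    apply: gr; rewrite // -ball_normE/= [ltRHS]splitr.
    by rewrite (le_lt_trans (ler_distD x' _ _))// ltrD// (lt_trans x'y).
  rewrite [ltRHS]splitr (le_lt_trans (ler_distD (g x) _ _))//.
  by rewrite ltrD// distrC.
move=> /(filterI (nbhs_right_gt 0)) /filter_ex[d [d_gt0 Pd]].
by exists d => // x y xS; exact: Pd.
Unshelve. all: by end_near. Qed.

Lemma compact_net (e : K) : 0 < e ->
  exists (I : finType) (p : I -> V), (forall i, S (p i)) /\
    forall x, S x -> exists i, `|p i - x| < e.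
Proof.
move=> e_gt0; move: S_compact; rewrite compact_cover => coverS.
have [|x xS|D DS SD] := coverS V S (fun x => ball x e).
- by move=> x _; exact: ball_open.
- by exists x => //; exact: ballxx.
exists (D : finType), val; split=> [i|x /SD[i /= iD]].
  exact/set_mem/DS/valP.
by rewrite -ball_normE; exists [` iD]%fset.
Qed.

Hypothesis S_convex : convex_set (S : set (convex_lmodType V)).
Hypothesis S_nonempty : S !=set0.
Hypothesis gS : forall x, S x -> S (g x).

(* Colour a grid point [a] by a net point [p i] close to [g (pt a)].  In the
   small fully coloured cell given by [sperner_grid] every net point carrying a
   significant weight is close to [g (pt a)], and so is their average [pt a]. *)
Lemma approx_fixed_point (e : K) : 0 < e ->
  exists2 x, S x & `|x - g x| <= e.
Proof.
move=> e_gt0; have e4_gt0 : 0 < e / 4 by rewrite divr_gt0.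
have [d d_gt0 gd] := heine_cantor e4_gt0.
have [I [p [pS p_net]]] := compact_net e4_gt0.
have [b b_gt0 Sb] := ex_strict_bound_gt0 (compact_bounded S_compact).
have [x0 x0S] := S_nonempty; have [i0 _] := p_net x0 x0S.
pose n : K := #|I|%:R.
have [q [q_gt0 qd qe]] : exists q : nat,
    [/\ 0 < q%:R :> K, n * n * b / q%:R < d & n * n * (b + b) / q%:R < e / 2].
  (* [B] adds the two lower bounds required of [q], so any natural number above it meets both. *)
  pose B := n * n * b / d + n * n * (b + b) / (e / 2).
  have n_ge0 : 0 <= n by rewrite ler0n.
  have B1_ge0 : 0 <= n * n * b / d.
    by rewrite divr_ge0 ?mulr_ge0 ?(ltW d_gt0) ?(ltW b_gt0).
  have B2_ge0 : 0 <= n * n * (b + b) / (e / 2).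
    by rewrite divr_ge0 ?mulr_ge0 ?addr_ge0 ?(ltW b_gt0)// ltW// divr_gt0.
  have Bq := archi_boundP (addr_ge0 B1_ge0 B2_ge0).
  have q_gt0 : 0 < (Num.bound B)%:R :> K.
    by apply: le_lt_trans Bq; rewrite addr_ge0.
  exists (Num.bound B); split=> //.
    rewrite ltr_pdivrMr// [ltRHS]mulrC -ltr_pdivrMr//; apply: le_lt_trans Bq.
    by rewrite lerDl.
  rewrite ltr_pdivrMr// [ltRHS]mulrC -ltr_pdivrMr ?divr_gt0//.
  apply: le_lt_trans Bq.
  by rewrite lerDr.
pose pt (a : {ffun I -> 'I_q.+1}) := \sum_i ((a i)%:R / q%:R) *: p i.
have ptS (a : {ffun I -> 'I_q.+1}) : (\sum_i a i)%N = q -> S (pt a).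
  move=> aq; apply: convex_set_sum => //.
  by rewrite -mulr_suml -natr_sum aq mulfV// gt_eqF.
pose c a := xget i0 [set i | `|p i - g (pt a)| < e / 4].
have cP (a : {ffun I -> 'I_q.+1}) : (\sum_i a i)%N = q ->
    `|p (c a) - g (pt a)| < e / 4.
  move=> /ptS/gS/p_net[i ip].
  exact: (xgetPex i0 (ex_intro [set i | `|p i - g (pt a)| < e / 4] i ip)).
have [C [m [/finset.set0Pn[i1 i1C] mC Ca]]] := sperner_grid c i0.
have [a [aq _ am]] := Ca i1 i1C.
exists (pt a); first exact: ptS.
(* The point [a'] of colour [i] lies in the same box above [m] as [a]. Hence [pt a] and [pt a']
   differ by at most [n * n * b / q%:R], which is less than [d], and their images by less than
   [e / 4]. *)
have lt_C i : i \in C -> `|p i - g (pt a)| < e / 2.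
  move=> /Ca[a' [a'q ca' a'm]].
  have -> : e / 2 = e / 4 + e / 4 by lra.
  rewrite (le_lt_trans (ler_distD (g (pt a')) _ _))// ltrD//.
    by rewrite -ca' cP.
  apply: gd; [exact: ptS|exact: ptS|].
  rewrite /pt -sumrB; under eq_bigr do rewrite -scalerBl -mulrBl.
  apply: le_lt_trans qd; apply: le_trans (ler_norm_sum _ _ _) _.
  have -> : n * n * b / q%:R = \sum_(j : I) n / q%:R * b.
    by rewrite sumr_const -[RHS]mulr_natl /n; ring.
  apply: ler_sum => j _; rewrite normrZ ler_pM//; last exact/ltW/Sb.
  rewrite normrM (@ger0_norm _ q%:R^-1) ?invr_ge0// ler_wpM2r ?invr_ge0//.
  have /andP[m1 m2] := am j; have /andP[m3 m4] := a'm j.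
  rewrite -!(ler_nat K) !natrD in m1 m2 m3 m4.
  by rewrite ler_norml; apply/andP; split; rewrite /n; lra.
have -> : pt a - g (pt a) = \sum_i ((a i)%:R / q%:R) *: (p i - g (pt a)).
  under eq_bigr do rewrite scalerBr.
  rewrite sumrB -scaler_suml -mulr_suml -natr_sum aq mulfV ?gt_eqF//.
  by rewrite scale1r.
apply: le_trans (ler_norm_sum _ _ _) _.
(* For [i] in [C] the distance is below [e / 2]. Otherwise [m i = 0], so the weight is at most
   [n / q%:R], and the distance is at most [b + b]. *)
apply: (@le_trans _ _
  (\sum_i ((a i)%:R / q%:R * (e / 2) + n / q%:R * (b + b)))).
  apply: ler_sum => i _.
  have ai_ge0 : 0 <= (a i)%:R / q%:R :> K by rewrite divr_ge0.
  rewrite normrZ (ger0_norm ai_ge0).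
  have [iC|iC] := boolP (i \in C).
    apply: ler_wpDr.
      by rewrite mulr_ge0 ?divr_ge0 ?addr_ge0 ?(ltW b_gt0)// ler0n.
    by rewrite ler_wpM2l// ltW// lt_C.
  apply: ler_wpDl; first by rewrite mulr_ge0 ?divr_ge0 ?(ltW e_gt0).
  apply: ler_pM => //.
    rewrite ler_wpM2r ?invr_ge0// ler_nat.
    by have /andP[_] := am i; rewrite mC.
  rewrite (le_trans (ler_normB _ _))// lerD//; apply/ltW/Sb => //.
  exact/gS/ptS.
have sum_l : \sum_i ((a i)%:R / q%:R) = 1 :> K.
  by rewrite -mulr_suml -natr_sum aq mulfV ?gt_eqF.
rewrite big_split/= -[X in X + _]mulr_suml sum_l mul1r.
have -> : \sum_(i : I) n / q%:R * (b + b) = n * n * (b + b) / q%:R.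
  by rewrite sumr_const -[LHS]mulr_natl /n; ring.
by move: qe; lra.
Qed.

(** The continuous displacement [x - g x] attains its least norm on the compact [S]. Were this
    positive, an approximate fixed point with half that error would contradict minimality. *)
Theorem schauder : exists2 x, S x & g x = x.
Proof.
have [|x xS xmin] :=
  @compact_EVT_min V K (fun x => `|x - g x|) S S_nonempty S_compact.
  move=> x; apply: cvg_norm; apply: cvgB; last exact: g_cont.
  by apply: (@continuous_subspaceT _ _ S id) => y; exact: cvg_id.
exists x; first exact/set_mem.
apply/esym/eqP; rewrite -subr_eq0 -normr_le0 leNgt; apply/negP => gx_gt0.
have [|y yS] := @approx_fixed_point (`|x - g x| / 2); first by rewrite divr_gt0.
apply/negP; rewrite -ltNge; apply: lt_le_trans (xmin y (mem_set yS)).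
by rewrite gtr_pMr// invf_lt1// ltr1n.
Qed.
End Schauder.

(** * Admissible polytopes and interval bounds *)

Lemma continuous_mx (T : topologicalType) (K : realType) (m n : nat)
    (h : T -> 'M[K]_(m, n)) :
  (forall i j, continuous (fun x => h x i j)) -> continuous h.
Proof.
move=> hij x; apply/cvg_ballP => e e_gt0.
have : \forall y \near x, forall i j, ball (h x i j) e (h y i j).
  apply: filter_forall => i; apply: filter_forall => j.
  by have /cvg_ballP/(_ e e_gt0) := hij i j x.
by apply: filterS => y hxy; split.
Qed.

Lemma continuous_mulmx (K : realType) (m n p : nat) (A : 'M[K]_(m, n)) :
  continuous (fun x : 'M[K]_(n, p) => A *m x).
Proof.
apply: continuous_mx => i j x; under eq_fun do rewrite mxE.
apply: (@cvg_big K _ +%R 0 _ (@add_continuous K) _ (nbhs x)) => k _.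
by apply: cvgMr; exact: coord_continuous.
Qed.

Lemma continuous_trmx (K : realType) (m n : nat) :
  continuous (fun x : 'M[K]_(m, n) => x^T).
Proof.
apply: continuous_mx => i j; under eq_fun do rewrite mxE.
exact: coord_continuous.
Qed.

Lemma mx_norm_trmx_le (K : realType) (m n : nat) (x : 'M[K]_(m, n)) :
  `|x^T| <= `|x|.
Proof.
rewrite [leLHS]/Num.norm [leRHS]/Num.norm/= !mx_normrE; apply/bigmax_leP; split.
  by apply/bigmax_geP; left.
by move=> [i j] _; apply/bigmax_geP; right; exists (j, i); rewrite ?mxE.
Qed.

(** Transposition is continuous and does not increase the norm, so the claim is carried over from
    row vectors. *)
Lemma bounded_closed_compact_cV (K : realType) (n : nat) (S : set 'cV[K]_n) :
  bounded_set S -> closed S -> compact S.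
Proof.
move=> bndS clS; have -> : S = trmx @` (trmx @^-1` S).
  apply/seteqP; split=> [x xS|_ [x xS <-] //].
  by exists x^T; rewrite /= trmxK.
apply: continuous_compact; first exact/continuous_subspaceT/continuous_trmx.
apply: bounded_closed_compact.
  case: bndS => M [Mreal SM]; exists M; split=> // N /SM SN x /SN.
  by apply: le_trans; rewrite -{1}(trmxK x) mx_norm_trmx_le.
by apply: closed_comp => // x _; exact: continuous_trmx.
Qed.

Lemma admissible_closed (K : realType) (n r : nat) (A : 'M[K]_(r, n)) l :
  closed (admissible A l).
Proof.
have -> : admissible A l = \bigcap_i
    ([set x | (- l.1) i 0 <= (A *m x) i 0] `&`
     [set x | (A *m x) i 0 <= l.2 i 0]).
  apply/seteqP; split=> [x [lx xl] i _|x xl].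
    by split; [exact: lx|exact: xl].
  by split=> i j; rewrite ord1; have [] := xl i Logic.I.
apply: closed_bigI => i _.
have cA : continuous (fun x : 'cV[K]_n => (A *m x) i 0).
  move=> x.
  apply: (@continuous_comp _ _ _ (mulmx A) (fun y : 'cV[K]_r => y i 0)).
    exact: continuous_mulmx.
  exact: coord_continuous.
apply: closedI.
  apply: (@closed_comp _ _ _ [set y : K | (- l.1) i 0 <= y]) => [x _|].
    exact: cA.
  exact: closed_ge.
apply: (@closed_comp _ _ _ [set y : K | y <= l.2 i 0]) => [x _|].
  exact: cA.
exact: closed_le.
Qed.

Lemma admissible_convex (K : realType) (n r : nat) (A : 'M[K]_(r, n)) l :
  convex_set (admissible A l : set (convex_lmodType 'cV[K]_n)).
Proof.
move=> x y t; rewrite !inE => -[lx xl] [ly yl].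
have t0 : 0 <= t%:num by [].
have t1 : t%:num <= 1 by [].
rewrite /conv/=; split=> i j; rewrite mulmxDr -!scalemxAr !mxE.
  have := lx i j; have := ly i j; rewrite !mxE => ly' lx'.
  have <- : t%:num * (- l.1 i j) + (1 - t%:num) * (- l.1 i j) = - l.1 i j.
    by ring.
  by rewrite lerD// ler_wpM2l// subr_ge0.
have <- : t%:num * l.2 i j + (1 - t%:num) * l.2 i j = l.2 i j by ring.
have := xl i j; have := yl i j; rewrite !mxE => yl' xl'.
by rewrite lerD// ler_wpM2l// subr_ge0.
Qed.

(** Interval arithmetic: the positive part of [F] keeps the two bounds in place and the negative
    part exchanges them. *)
Lemma mulmx_bounds (K : realType) (m n : nat) (F : 'M[K]_(m, n))
    (v lo hi : 'cV[K]_n) :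
  - lo <=m v <=m hi ->
  - (pospart F *m lo + negpart F *m hi) <=m F *m v <=m
    pospart F *m hi + negpart F *m lo.
Proof.
move=> [lov vhi].
have -> : F *m v = pospart F *m v - negpart F *m v.
  by rewrite -mulmxBl -posnegpartE.
have pos_ge0 i k : 0 <= pospart F i k by rewrite mxE le_max lexx orbT.
have neg_ge0 i k : 0 <= negpart F i k by rewrite mxE le_max lexx orbT.
have lov' k j : - v k j <= lo k j by have := lov k j; rewrite mxE lerNl.
move: (pospart F) (negpart F) pos_ge0 neg_ge0 => P N P_ge0 N_ge0.
split=> i j; rewrite !mxE ?opprD -!sumrN; apply: lerD; apply: ler_sum => k _.
- by rewrite -mulrN ler_wpM2l// lerNl.
- by rewrite lerN2 ler_wpM2l.
- by rewrite ler_wpM2l.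
- by rewrite -mulrN ler_wpM2l.
Qed.

(** * Existence of a feasible solution from self-consistent bounds *)

Theorem mainTheorem1 (K : realType) (n m k l r : nat)
    (f : 'cV[K]_n -> 'cV[K]_m) (f_diff : forall x, differentiable f x)
    (M : 'M[K]_(n, m)) (R : 'M[K]_(n, k)) (T : 'M[K]_(l, m))
    (xs : 'cV[K]_n) (us : 'cV[K]_k) :
  let h := fun x : 'cV[K]_n => T *m f x in
  let L := jac f xs in
  let J := M *m L in
  forall (hs_le0 : h xs <=m 0) (J_unit : J \in unitmx)
    (A : 'M[K]_(r, n))
    (A_polytope : forall lm lp : 'cV[K]_r, 0 <=m lm -> 0 <=m lp ->
       is_polytope (admissible A (lm, lp)))
    (lmaxm lmaxp : 'cV[K]_r) (lmaxm_ge0 : 0 <=m lmaxm) (lmaxp_ge0 : 0 <=m lmaxp)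
    (d2fm d2fp : 'cV[K]_r * 'cV[K]_r -> 'cV[K]_m)
    (d2f_bound : forall lm lp : 'cV[K]_r, 0 <=m lm -> 0 <=m lp ->
       forall z : 'cV[K]_n, admissible A (lm, lp) z ->
         - d2fm (lm, lp) <=m delta2 f xs (xs + z) <=m d2fp (lm, lp)),
  let B := A *m invmx J *m R in
  let C := - (A *m invmx J *m M) in
  let D := T *m L *m invmx J *m R in
  let E := T - T *m L *m invmx J *m M in
  forall (lxm lxp : 'cV[K]_r) (lum lup : 'cV[K]_k)
    (lxm_ge0 : 0 <=m lxm) (lxp_ge0 : 0 <=m lxp)
    (lxp_self : pospart B *m lup + negpart B *m lum
       + pospart C *m d2fp (lxm, lxp) + negpart C *m d2fm (lxm, lxp) <=m lxp)
    (lxm_self : pospart B *m lum + negpart B *m lup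
       + pospart C *m d2fm (lxm, lxp) + negpart C *m d2fp (lxm, lxp) <=m lxm)
    (lxp_max : lxp <=m lmaxp) (lxm_max : lxm <=m lmaxm)
    (nonlin_feas : pospart D *m lup + negpart D *m lum
       + pospart E *m d2fp (lxm, lxp) + negpart E *m d2fm (lxm, lxp)
       + h xs <=m 0),
  forall u : 'cV[K]_k, - lum <=m u - us <=m lup ->
  exists x : 'cV[K]_n,
    [/\ M *m f x = M *m f xs + R *m (u - us),
        - lxm <=m A *m (x - xs) <=m lxp,
        h x <=m 0 &
        - lmaxm <=m A *m (x - xs) <=m lmaxp].
Proof.
move=> h L J hs_le0 J_unit A A_polytope lmaxm lmaxp _ _ d2fm d2fp d2f_bound.
move=> B C D E lxm lxp lum lup lxm_ge0 lxp_ge0 lxp_self lxm_self lxp_max lxm_max.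
move=> nonlin_feas u u_bnd.
have addE p (x y : 'cV[K]_p) i j : (x + y) i j = x i j + y i j by rewrite mxE.
have oppE p (x : 'cV[K]_p) i j : (- x) i j = - x i j by rewrite mxE.
pose du := u - us; pose d z := delta2 f xs (xs + z).
pose S := admissible A (lxm, lxp).
pose G z := invmx J *m (R *m du - M *m d z).
have AGE z : A *m G z = B *m du + C *m d z.
  by rewrite /G /B /C mulmxA mulmxBr !mulmxA mulNmx.
have cd : continuous d.
  have cxs : continuous (fun z : 'cV[K]_n => xs + z).
    by move=> z; apply: continuousD; [exact: cst_continuous|exact: cvg_id].
  have cf : continuous (fun z => f (xs + z)).
    move=> z; apply: (continuous_comp (cxs z)).
    exact: differentiable_continuous.
  have cL : continuous (fun z => L *m (xs + z - xs)).
    move=> z; apply: (@continuous_comp _ _ _ (fun z => xs + z - xs) (mulmx L)).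
      apply: (@continuousB K 'cV[K]_n _ _ (cst xs)); first exact: cxs.
      exact: cst_continuous.
    exact: continuous_mulmx.
  move=> z; apply: (@continuousB K 'cV[K]_m _ (fun z => f (xs + z) - f xs)).
    apply: (@continuousB K 'cV[K]_m _ _ (cst (f xs))); first exact: cf.
    exact: cst_continuous.
  exact: cL.
have [z zS Gz] : exists2 z, S z & G z = z.
  apply: schauder.
  - apply: bounded_closed_compact_cV; last exact: admissible_closed.
    by have [] := A_polytope _ _ lxm_ge0 lxp_ge0.
  - apply: continuous_subspaceT => z.
    apply: (@continuous_comp _ _ _ (fun z => R *m du - M *m d z)
      (mulmx (invmx J))).
      apply: (@continuousB K 'cV[K]_n _ (cst (R *m du))).
        exact: cst_continuous.
      apply: (@continuous_comp _ _ _ d (mulmx M)); first exact: cd.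
      exact: continuous_mulmx.
    exact: continuous_mulmx.
  - exact: admissible_convex.
  - exists 0; rewrite /S /admissible/= mulmx0; split=> // i j.
    by have := lxm_ge0 i j; rewrite !mxE oppr_le0.
  (* The interval bounds for [B *m du] and [C *m d z] add up to the left-hand sides of the two
     self-consistency constraints. *)
  - move=> z zS; have [Bl Bu] := mulmx_bounds B u_bnd.
    have [Cl Cu] := mulmx_bounds C (d2f_bound _ _ lxm_ge0 lxp_ge0 z zS).
    rewrite /S /admissible/= AGE; split=> i j.
      have := lxm_self i j; have := Bl i j; have := Cl i j; rewrite !(addE, oppE).
      lra.
    have := lxp_self i j; have := Bu i j; have := Cu i j; rewrite !(addE, oppE).
    lra.
have dz : f (xs + z) = f xs + L *m z + d z.
  rewrite /d /delta2 [xs + z - xs]addrAC subrr add0r -/L.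
  by rewrite -[f (xs + z) - _ - _]addrA -opprD [RHS]addrC subrK.
have Jz : J *m z = R *m du - M *m d z.
  by rewrite -[in LHS]Gz /G mulmxA mulmxV// mul1mx.
have zE : z = invmx J *m R *m du - invmx J *m M *m d z.
  by rewrite -{1}Gz /G mulmxBr !mulmxA.
have [zl zu] := zS.
exists (xs + z); rewrite [xs + z - xs]addrAC subrr add0r; split=> //.
(* Since [M *m L] is [J], [Jz] turns the linear term into [R *m du - M *m d z], and the residual
   cancels. *)
- rewrite -/du dz (mulmxDr M (_ + _) (d z)) (mulmxDr M (f xs)).
  by rewrite [M *m (L *m z)]mulmxA -/J Jz -addrA subrK.
(* Inserting [zE] into [T *m L *m z] yields [D *m du] and a residual term that combines with
   [T *m d z] to [E *m d z]. *)
- have -> : h (xs + z) = h xs + D *m du + E *m d z.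
    rewrite /h dz (mulmxDr T (_ + _) (d z)) (mulmxDr T (f xs)) [in L *m z]zE.
    rewrite /D /E mulmxBl (mulmxBr L) (mulmxBr T) !mulmxA -!addrA.
    by congr (_ + (_ + _)); exact: addrC.
  have [_ Du] := mulmx_bounds D u_bnd.
  have [_ Eu] := mulmx_bounds E (d2f_bound _ _ lxm_ge0 lxp_ge0 z zS).
  move=> i j; have := nonlin_feas i j; have := Du i j; have := Eu i j.
  rewrite !(addE, mxE _ 0); lra.
- split=> i j; last exact: le_trans (zu i j) (lxp_max i j).
  have := lxm_max i j; have := zl i j; rewrite !oppE; lra.
Qed.
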